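(* Let $\sigma$ be a partition of the set of all primes, $\tau$ a subgroup functor and $n$ a non-negative integer. The lattice $l^{\tau}_{\sigma_n}$ of all $\tau$-closed $n$-multiply $\sigma$-local formations (ordered by inclusion, with meet $\cap$ and join $\vee^{\tau}_{\sigma_n}$) is modular.
   Context: All groups are finite; classes of groups are closed under isomorphism. $\sigma=\{\sigma_i\mid i\in I\}$ is a partition of the set $\mathbb{P}$ of all primes; $\pi(G)$ is the set of primes dividing $|G|$; $\sigma(G)=\{\sigma_i\mid \sigma_i\cap\pi(G)\neq\emptyset\}$ and $\sigma(\mathfrak{X})=\bigcup_{G\in\mathfrak{X}}\sigma(G)$. $\sigma_i'=\mathbb{P}\setminus\sigma_i$; $O_{\sigma_i}(G)$, $O_{\sigma_i'}(G)$ are the largest normal $\sigma_i$-subgroup and $\sigma_i'$-subgroup of $G$; $F_{\{\sigma_i\}}(G)=O_{\sigma_i',\sigma_i}(G)$ is defined by $O_{\sigma_i',\sigma_i}(G)/O_{\sigma_i'}(G)=O_{\sigma_i}(G/O_{\sigma_i'}(G))$. A formation is a class of groups $\mathfrak F$ such that $G\in\mathfrak F$ implies $G/N\in\mathfrak F$, and $G/N,G/R\in\mathfrak F$ implies $G/(N\cap R)\in\mathfrak F$. A formation $\sigma$-function is a function $f:\sigma\to\{\text{formations of groups}\}$ (the value $\emptyset$ is allowed); $LF_\sigma(f)$ is the class of all $G$ such that $G=1$, or $G\ne1$ and $G/F_{\{\sigma_i\}}(G)\in f(\sigma_i)$ for all $\sigma_i\in\sigma(G)$. Every formation is $0$-multiply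 $\sigma$-local; for $n>0$ a formation $\mathfrak F$ is $n$-multiply $\sigma$-local if either $\mathfrak F=(1)$ (the class of identity groups) or $\mathfrak F=LF_\sigma(f)$ where $f(\sigma_i)$ is $(n-1)$-multiply $\sigma$-local for all $\sigma_i\in\sigma(\mathfrak F)$. A subgroup functor $\tau$ assigns to each group $G$ a set $\tau(G)$ of subgroups of $G$ with $G\in\tau(G)$ such that for every epimorphism $\varphi:A\to B$ and all $H\in\tau(A)$, $T\in\tau(B)$ we have $H^{\varphi}\in\tau(B)$ and $T^{\varphi^{-1}}\in\tau(A)$. A class $\mathfrak F$ is $\tau$-closed if $\tau(G)\subseteq\mathfrak F$ for all $G\in\mathfrak F$. For formations $\mathfrak M,\mathfrak H\in l^{\tau}_{\sigma_n}$, $\mathfrak M\vee^{\tau}_{\sigma_n}\mathfrak H$ is the intersection of all $\tau$-closed $n$-multiply $\sigma$-local formations containing $\mathfrak M\cup\mathfrak H$. With these operations $l^{\tau}_{\sigma_n}$ is a lattice. *)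

(* Defs.v *)
From mathcomp Require Import all_boot all_fingroup all_solvable.

Set Implicit Arguments.
Unset Strict Implicit.
Unset Printing Implicit Defensive.

Import GroupScope.

(* Any set of primes is a nat_pred classically, so boolean blocks lose no
   generality.  Blocks are nonempty and pairwise disjoint, so the indexing
   by I is injective and functions on the partition are functions on I. *)
Definition prime_partition (I : Type) (sigma : I -> nat_pred) : Prop :=
  [/\ forall i p, p \in sigma i -> prime p,
      forall i, exists p, p \in sigma i,
      forall i j p, p \in sigma i -> p \in sigma j -> i = j
    & forall p, prime p -> exists i, p \in sigma i].

(* A class of groups is a gclass that is moreover iso_closed. *)
Definition gclass := forall gT : finGroupType, {group gT} -> Prop.

Definition iso_closed (F : gclass) : Prop :=
  forall (gT rT : finGroupType) (G : {group gT}) (H : {group rT}),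
    G \isog H -> F gT G -> F rT H.

Definition subclass (F H : gclass) : Prop :=
  forall (gT : finGroupType) (G : {group gT}), F gT G -> H gT G.

Definition eqclass (F H : gclass) : Prop :=
  forall (gT : finGroupType) (G : {group gT}), F gT G <-> H gT G.

Definition class1 : gclass := fun gT G => G :=: 1.

Definition classI (F H : gclass) : gclass := fun gT G => F gT G /\ H gT G.

(* The empty class is a formation. *)
Definition formation (F : gclass) : Prop :=
  [/\ iso_closed F,
      forall (gT : finGroupType) (G N : {group gT}),
        N <| G -> F gT G -> F (coset_of N) (G / N)%G
    & forall (gT : finGroupType) (G N R : {group gT}),
        N <| G -> R <| G ->
        F (coset_of N) (G / N)%G -> F (coset_of R) (G / R)%G ->
        F (coset_of (N :&: R)) (G / (N :&: R))%G].

Definition sigma_of_group (I : Type) (sigma : I -> nat_pred)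
    (gT : finGroupType) (G : {group gT}) (i : I) : Prop :=
  exists p : nat, p \in sigma i /\ p \in \pi(G).

Definition sigma_of_class (I : Type) (sigma : I -> nat_pred)
    (F : gclass) (i : I) : Prop :=
  exists (gT : finGroupType) (G : {group gT}),
    F gT G /\ sigma_of_group sigma G i.

Definition LF (I : Type) (sigma : I -> nat_pred) (f : I -> gclass) : gclass :=
  fun gT G =>
    G :=: 1 \/
    (G :!=: 1 /\
     forall i, sigma_of_group sigma G i ->
       f i (coset_of 'O_{(sigma i)^', sigma i}(G))
           (G / 'O_{(sigma i)^', sigma i}(G))%G).

Fixpoint multiply_local (I : Type) (sigma : I -> nat_pred) (n : nat)
    (F : gclass) : Prop :=
  if n is m.+1 then
    formation F /\
    (eqclass F class1 \/
     exists f : I -> gclass,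
       [/\ forall i, formation (f i),
           eqclass F (LF sigma f)
         & forall i, sigma_of_class sigma F i -> multiply_local sigma m (f i)])
  else formation F.

Definition subgroup_map :=
  forall gT : finGroupType, {group gT} -> {set {group gT}}.

Definition subgroup_functor (tau : subgroup_map) : Prop :=
  [/\ forall (gT : finGroupType) (G H : {group gT}),
        H \in tau gT G -> H \subset G,
      forall (gT : finGroupType) (G : {group gT}), G \in tau gT G
    & forall (aT rT : finGroupType) (A : {group aT}) (B : {group rT})
             (phi : {morphism A >-> rT}),
        phi @* A = B ->
        (forall H : {group aT}, H \in tau aT A -> (phi @* H)%G \in tau rT B) /\
        (forall T : {group rT}, T \in tau rT B ->
           (phi @*^-1 T)%G \in tau aT A)].

Definition tau_closed (tau : subgroup_map) (F : gclass) : Prop :=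
  forall (gT : finGroupType) (G H : {group gT}),
    F gT G -> H \in tau gT G -> F gT H.

Definition l_tau_sigma (I : Type) (sigma : I -> nat_pred)
    (tau : subgroup_map) (n : nat) (F : gclass) : Prop :=
  tau_closed tau F /\ multiply_local sigma n F.

Definition join_tau_sigma (I : Type) (sigma : I -> nat_pred)
    (tau : subgroup_map) (n : nat) (M H : gclass) : gclass :=
  fun gT G =>
    forall F : gclass, l_tau_sigma sigma tau n F ->
      subclass M F -> subclass H F -> F gT G.

(* A family L of classes, ordered by inclusion; equality of classes is
   extensional. *)
Definition is_lattice (L : gclass -> Prop)
    (meet join : gclass -> gclass -> gclass) : Prop :=
  forall A B : gclass, L A -> L B ->
    [/\ L (meet A B), subclass (meet A B) A, subclass (meet A B) B
      & forall C, L C -> subclass C A -> subclass C B ->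
          subclass C (meet A B)] /\
    [/\ L (join A B), subclass A (join A B), subclass B (join A B)
      & forall C, L C -> subclass A C -> subclass B C ->
          subclass (join A B) C].

Definition modular_law (L : gclass -> Prop)
    (meet join : gclass -> gclass -> gclass) : Prop :=
  forall A B C : gclass, L A -> L B -> L C -> subclass A C ->
    eqclass (join A (meet B C)) (meet (join A B) C).

Definition modular_lattice (L : gclass -> Prop)
    (meet join : gclass -> gclass -> gclass) : Prop :=
  is_lattice L meet join /\ modular_law L meet join.

(* Main.v *)
From HB Require Import structures.
Require Import Defs.
From mathcomp Require Import all_boot all_fingroup all_solvable ssralg zmodp.
From Stdlib Require Import Classical.

Set Implicit Arguments.
Unset Strict Implicit.
Unset Printing Implicit Defensive.
Import GroupScope.

(** Write F_i(G) for 'O_{(sigma i)^', sigma i}(G), so that LF(f) consists of the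
    groups G with G / F_i(G) in f(i) for every block sigma i that meets the
    primes of G; and say that a formation has level n when it is n-multiply
    local.  The proof is an induction on n.

    For n = 0 the classes are tau-closed formations.  If A and B are nonempty
    formations, their join consists of the images f(H) of groups H having
    normal subgroups K1, K2 with H / K1 in A, H / K2 in B and K1 :&: K2 in the
    kernel of f; when A and B are tau-closed, so is this class.  Let G = f(H)
    belong to the join and to C, where A is contained in C, and let N be the
    kernel of f.  Then H / (K1 :&: N) is in C, so H / (K1 :&: N) K2 is in both
    B and C, while H / K1 is in A.  By Dedekind's law
    K1 :&: (K1 :&: N) K2 = (K1 :&: N) (K1 :&: K2), which is contained in N, so G
    is in the join of A with the intersection of B and C
    (subdirect_join_modular).

    For the step, each class X of level n + 1 is written as LF(f) with a
    function f that has values of level n, is monotone in X, commutes with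
    intersections, and inherits tau-closure from X.  Then A, B and C can be
    replaced by the values of their functions: LF of the pointwise join
    contains A and B, hence their join; the induction hypothesis is applied to
    each value; and the values of any class containing A and the intersection
    of B and C contain the values of A and of that intersection.

    Such a function is canonical_def X: its value at i is the class of all G
    such that, for every prime p in sigma i, X contains a wreath product of a
    group of order p with G.  Monotonicity, compatibility with intersections
    and tau-closure can be read off this description.  That the function
    defines X and has values of level n follows from another one: if X = LF(f)
    with values of level n, then the value at i consists of the G such that
    G / 'O_(sigma i)(G) lies in f(i) and in X (canonical_def_pcore_ext).  The
    wreath product enters because its base group, a p-group, contains its own
    centralizer.  This makes the (sigma i)'-core of the wreath product trivial
    (wreath_over_pcore), so that its membership in LF(f) constrains the
    quotient by a (sigma i)-group.  The values have level n because each level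
    is stable under extensions by normal (sigma i)-subgroups
    (multilocal_pcore_ext), which rests on an explicit function for the
    extended class (pcore_ext_LF).

    The induction runs over the classes of level n together with the empty
    class, which occurs as a value of canonical_def. *)

(** * Quotients, surjections and formations *)

Lemma iso_closed_quo1 F (gT : finGroupType) (G : {group gT}) :
  iso_closed F -> F gT G <-> F _ (G / 1)%G.
Proof.
by move=> isoF; split; apply: isoF; [|rewrite isog_sym]; apply: quotient1_isog.
Qed.

Lemma preim_im (gT rT : finGroupType) (G : {group gT}) (H : {group rT})
    (f : {morphism G >-> rT}) : f @* G = H -> f @*^-1 H = G.
Proof. by move=> <-; rewrite morphimGK ?subsetIl. Qed.

Lemma preim_normal (gT rT : finGroupType) (G : {group gT}) (H K : {group rT})
    (f : {morphism G >-> rT}) : f @* G = H -> K <| H -> f @*^-1 K <| G.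
Proof.
move=> fGH nKH; have := @morphpre_normal _ _ _ f K H.
by rewrite (preim_im fGH) fGH nKH normal_sub // => ->.
Qed.

(** Morphisms carry their domain in their type, so composites along a
    surjection are used through their image and kernel only. *)
Lemma comp_surj (gT rT kT : finGroupType) (G : {group gT}) (H D : {group rT})
    (f : {morphism G >-> rT}) (g : {morphism D >-> kT}) :
  f @* G = H -> H \subset D ->
  exists q : {morphism G >-> kT},
    q @* G = g @* H /\ 'ker q = f @*^-1 'ker g.
Proof.
move=> fGH sHD.
have sGdom: G \subset f @*^-1 D by rewrite -sub_morphim_pre // fGH.
exists (restrm_morphism sGdom (comp_morphism f g)); split.
  by rewrite morphim_restrm setIid morphim_comp fGH.
by rewrite ker_restrm ker_comp; apply/setIidPr/subsetIl.
Qed.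

(** Membership of quotients can be pulled back along a surjection; this is what
    lets several groups be compared inside one common cover. *)
Lemma quo_preim F (gT rT : finGroupType) (G : {group gT}) (H K : {group rT})
    (f : {morphism G >-> rT}) :
  iso_closed F -> f @* G = H -> K <| H ->
  F _ (G / (f @*^-1 K))%G <-> F _ (H / K)%G.
Proof.
move=> isoF fGH /andP[_ nKH].
have [q [qG kerq]] := comp_surj (coset_morphism K) fGH nKH.
have isoq : (G / (f @*^-1 K)) \isog (H / K).
  by rewrite [H / K]/quotient -qG -[in f @*^-1 K](ker_coset K) -kerq first_isog.
by split; apply: isoF; rewrite // isog_sym.
Qed.

Lemma quo_sub F (gT : finGroupType) (G N M : {group gT}) :
  formation F -> N <| G -> M <| G -> N \subset M ->
  F _ (G / N)%G -> F _ (G / M)%G.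
Proof.
move=> [isoF quoF _] nNG nMG sNM FN.
apply: isoF (quoF _ _ (M / N)%G _ FN); first exact: third_isog.
exact: quotient_normal.
Qed.

Lemma quo_quo F (gT : finGroupType) (G N M : {group gT}) :
  iso_closed F -> N <| G -> M <| G -> N \subset M ->
  F _ (G / N / (M / N))%G <-> F _ (G / M)%G.
Proof.
move=> isoF nNG nMG sNM.
by split; apply: isoF; [|rewrite isog_sym]; exact: third_isog.
Qed.

Lemma formation_trivial F (gT rT : finGroupType) (G : {group gT})
    (H : {group rT}) :
  formation F -> F _ G -> H :=: 1 -> F _ H.
Proof.
move=> [isoF quoF _] FG H1.
apply: (isoF _ _ (G / G)%G); last exact: quoF (normal_refl G) FG.
by apply: trivial_isog => //; apply: trivg_quotient.
Qed.

Lemma formation_im F (gT rT : finGroupType) (G : {group gT}) (H : {group rT})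
    (f : {morphism G >-> rT}) :
  formation F -> f @* G = H -> F _ G -> F _ H.
Proof.
move=> [isoF quoF _] fGH FG.
apply: isoF (quoF _ _ ('ker f)%G _ FG); first by rewrite -fGH first_isog.
exact: ker_normal.
Qed.

Lemma formation_imquo F (gT rT : finGroupType) (G N : {group gT})
    (H K : {group rT}) (f : {morphism G >-> rT}) :
  formation F -> f @* G = H -> N <| G -> K <| H -> f @* N \subset K ->
  F _ (G / N)%G -> F _ (H / K)%G.
Proof.
move=> formF fGH nNG nKH sfNK FN; have [isoF _ _] := formF.
apply/(quo_preim isoF fGH nKH); apply: quo_sub FN => //.
  exact: preim_normal nKH.
by rewrite -sub_morphim_pre // normal_sub.
Qed.

(** Closure under isomorphism and under quotients are both instances of closure
    under surjective images. *)
Lemma formation_build F :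
  (forall (gT rT : finGroupType) (G : {group gT}) (H : {group rT})
     (f : {morphism G >-> rT}), f @* G = H -> F _ G -> F _ H) ->
  (forall (gT : finGroupType) (G N R : {group gT}),
        N <| G -> R <| G ->
        F (coset_of N) (G / N)%G -> F (coset_of R) (G / R)%G ->
        F (coset_of (N :&: R)) (G / (N :&: R))%G) ->
  formation F.
Proof.
move=> imF RF; split=> //.
  by move=> gT rT G H /isogP[f _ fGH] FG; apply: imF fGH FG.
move=> gT G N nNG FG.
have nNG' := normal_norm nNG.
apply: (imF _ _ _ _ (restrm_morphism nNG' (coset_morphism N))) FG.
by rewrite morphim_restrm setIid.
Qed.

Lemma formation_eq F F' : eqclass F F' -> formation F -> formation F'.
Proof.
move=> e [i q r]; split=> [gT rT G H iGH|gT G N nNG|gT G N R nN nR].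
- by rewrite -!e; apply: i.
- by rewrite -!e; apply: q.
- by rewrite -!e; apply: r.
Qed.

Lemma formation_bigI (P : gclass -> Prop) :
  (forall F, P F -> formation F) ->
  formation (fun gT G => forall F, P F -> F gT G).
Proof.
move=> fP; split.
- move=> gT rT G H iGH FG F PF; case: (fP F PF) => i _ _.
  exact: i iGH (FG F PF).
- by move=> gT G N nN FG F PF; case: (fP F PF) => _ q _; apply: q (FG F PF).
move=> gT G N R nN nR FN FR F PF; have [_ _ r] := fP F PF.
exact: r nN nR (FN F PF) (FR F PF).
Qed.

Lemma classI_bigI X Y :
  eqclass (fun gT G => forall F, F = X \/ F = Y -> F gT G) (classI X Y).
Proof.
move=> gT G; split=> [FG|[XG YG] F [] -> //].
by split; apply: FG; [left | right].
Qed.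

Lemma formation_classI X Y :
  formation X -> formation Y -> formation (classI X Y).
Proof.
move=> fX fY; apply: formation_eq (classI_bigI X Y) _.
by apply: formation_bigI => F [] ->.
Qed.

(** Applied to properties that are not decidable, such as membership of G / N
    in a class: this is how residuals are obtained. *)
Lemma least_subgroup (gT : finGroupType) (P : {group gT} -> Prop)
    (A : {group gT}) :
  P A -> (forall N M, P N -> P M -> P (N :&: M)%G) ->
  exists D, P D /\ forall M, P M -> D \subset M.
Proof.
move=> PA PI; have [n] := ubnP #|A|; elim: n A PA => // n IH A PA leAn.
have [lA|/not_all_ex_not[M /(@imply_to_and (P M))[PM /negP sAM]]] :=
  classic (forall M, P M -> A \subset M); first by exists A.
apply: (IH (A :&: M)%G); first exact: PI.
apply: (@leq_trans #|A|); last by rewrite -ltnS.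
apply: proper_card.
by rewrite properE subsetIl subsetI subxx.
Qed.

Lemma pnat_index_setIr pi (gT : finGroupType) (G A N B : {group gT}) :
  A \subset G -> N <| G -> N \subset A ->
  pi.-nat #|A : N| -> pi.-nat #|A :&: B : N :&: B|.
Proof.
move=> sAG nNG sNA; apply: pnat_dvd.
have nNA : A \subset 'N(N) := subset_trans sAG (normal_norm nNG).
have -> : N :&: B = (A :&: B) :&: N by rewrite setIAC (setIidPr sNA).
rewrite indexgI -!card_quotient ?cardSg ?quotientS ?subsetIl //.
by rewrite (subset_trans _ nNA) ?subsetIl.
Qed.

(** Pass from A :&: B to N :&: R through N :&: B; the two successive indices
    divide one of the given indices. *)
Lemma pnat_index_setI pi (gT : finGroupType) (G A N B R : {group gT}) :
  A \subset G -> N <| G -> B \subset G -> R <| G ->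
  N \subset A -> R \subset B ->
  pi.-nat #|A : N| -> pi.-nat #|B : R| -> pi.-nat #|A :&: B : N :&: R|.
Proof.
move=> sAG nNG sBG nRG sNA sRB piN piR.
rewrite -(@Lagrange_index _ (A :&: B) (N :&: B) (N :&: R)).
- rewrite pnatM (pnat_index_setIr _ sAG) //= setIC [N :&: R]setIC.
  exact: (pnat_index_setIr _ sBG).
- exact: setSI.
exact: setIS.
Qed.

(** * One block at a time: local conditions and extensions by pi-groups *)

(** The condition that a single block of primes contributes to LF; LF is the
    intersection of these classes (lemma LFP). *)
Definition local_at (pi : nat_pred) (X : gclass) : gclass := fun gT G =>
  ~~ pi^'.-group G -> X _ (G / 'O_{pi^', pi}(G))%G.

(** The product class of the pi-groups and X. *)
Definition pcore_ext (pi : nat_pred) (X : gclass) : gclass := fun gT G =>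
  X _ (G / 'O_pi(G))%G.

(** Indices take the place of the quotients of G, so that different N can be
    compared inside one group. *)
Definition normal_pi'pi (pi : nat_pred) (gT : finGroupType)
    (G N U : {group gT}) :=
  U <| G /\ exists V : {group gT},
    [/\ V <| G, N \subset V, V \subset U,
        pi^'.-nat #|V : N| & pi.-nat #|U : V|].

Lemma normal_pi'pi_max pi (gT : finGroupType) (G U : {group gT}) :
  normal_pi'pi pi G 1 U -> U \subset 'O_{pi^', pi}(G).
Proof.
case=> nUG [V [nVG _ sVU]]; rewrite indexg1 => pV pUV.
have sVO : V \subset 'O_pi^'(G) by apply: pcore_max.
have nOG := pcore_normal pi^' G.
have sOO : 'O_pi^'(G) \subset 'O_{pi^', pi}(G).
  by rewrite -pseries1 (pseries_sub_catl [:: _] [:: _]).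
have nUO : U \subset 'N('O_pi^'(G)).
  by apply: subset_trans (normal_sub nUG) (normal_norm nOG).
rewrite -(quotientSGK nUO sOO) quotient_pseries2.
apply: pcore_max; last exact: quotient_normal.
rewrite /pgroup card_quotient //.
apply: pnat_dvd pUV; exact: indexgS.
Qed.

Lemma pseries2_normal_pi'pi pi (gT : finGroupType) (G : {group gT}) :
  normal_pi'pi pi G 1 'O_{pi^', pi}(G)%G.
Proof.
split; first exact: pseries_normal.
have sOO : 'O_pi^'(G) \subset 'O_{pi^', pi}(G).
  by rewrite -pseries1 (pseries_sub_catl [:: _] [:: _]).
exists 'O_pi^'(G)%G; split=> //; rewrite ?sub1G ?pcore_normal //.
  by rewrite indexg1; apply: pcore_pgroup.
rewrite -card_quotient; last first.
  by apply: subset_trans (pseries_sub _ _) (normal_norm (pcore_normal _ _)).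
by rewrite /= quotient_pseries2; apply: pcore_pgroup.
Qed.

Lemma normal_pi'pi_quo pi (gT : finGroupType) (G N U : {group gT}) :
  N <| G -> U <| G -> N \subset U ->
  normal_pi'pi pi (G / N)%G 1%G (U / N)%G <-> normal_pi'pi pi G N U.
Proof.
move=> nNG nUG sNU; have nNG' := normal_norm nNG.
have idx (X Y : {group gT}) : X <| G -> N \subset Y -> Y \subset X ->
    #|X / N : Y / N| = #|X : Y|.
  move=> nXG sNY sYX; rewrite index_quotient_eq //.
  - by rewrite (subset_trans _ sNY) // subsetIr.
  - exact: subset_trans (normal_sub nXG) nNG'.
split=> [[_ [V' [nV' _ sV' pV' pUV']]]|[_ [V [nV sNV sVU pV pUV]]]].
  have [V eV sNV nVG] := inv_quotientN nNG nV'.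
  have sVU : V \subset U.
    have := sV'; rewrite eV quotientSGK //.
    by apply: subset_trans (normal_sub nVG) nNG'.
  split=> //; exists V; split=> //.
    by rewrite -(idx V N) // trivg_quotient -eV.
  by rewrite -(idx U V) // -eV.
split; first exact: quotient_normal.
exists (V / N)%G; split; rewrite ?quotient_normal ?sub1G ?quotientS //.
  by move: pV; rewrite -(idx V N) // trivg_quotient.
by rewrite idx.
Qed.

Lemma local_at_quoP pi X (gT : finGroupType) (G N : {group gT}) :
  formation X -> N <| G ->
  local_at pi X (G / N)%G <->
  (~~ pi^'.-nat #|G : N| -> exists U, normal_pi'pi pi G N U /\ X _ (G / U)%G).
Proof.
move=> fX nNG; have [isoX _ _] := fX.
rewrite /local_at /pgroup card_quotient ?normal_norm //.
split=> XG /XG {XG}.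
  have := pseries2_normal_pi'pi pi (G / N)%G; set O := 'O_{_, _}(_)%G => pO XO.
  have [nOG _] := pO.
  have [U eU sNU nUG] := inv_quotientN nNG nOG.
  have eO : O = (U / N)%G by apply: val_inj.
  exists U; split; first by apply/(normal_pi'pi_quo _ nNG nUG sNU); rewrite -eO.
  by apply/(quo_quo isoX nNG nUG sNU); rewrite -eO.
case=> U [pU XU]; have [nUG [V [_ sNV sVU _ _]]] := pU.
have sNU := subset_trans sNV sVU.
have pUN : normal_pi'pi pi (G / N)%G 1%G (U / N)%G by apply/normal_pi'pi_quo.
apply: quo_sub (normal_pi'pi_max pUN) _ => //.
- exact: quotient_normal.
- exact: pseries_normal.
by apply/quo_quo.
Qed.

Lemma local_atP pi X (gT : finGroupType) (G : {group gT}) :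
  formation X ->
  local_at pi X G <->
  (~~ pi^'.-group G -> exists U, normal_pi'pi pi G 1 U /\ X _ (G / U)%G).
Proof.
move=> fX; split=> XG /XG {XG}.
  move=> XG; exists 'O_{pi^', pi}(G)%G; split=> //.
  exact: pseries2_normal_pi'pi.
case=> U [pU XU]; apply: quo_sub (normal_pi'pi_max pU) XU => //.
  by case: pU.
exact: pseries_normal.
Qed.

(** Let U / N and T / R be normal pi'-by-pi subgroups of G / N and G / R with
    G / U and G / T in X.  Then (U :&: T) / (N :&: R) is pi'-by-pi and
    G / (U :&: T) is in X. *)
Lemma local_at_formation pi X : formation X -> formation (local_at pi X).
Proof.
move=> fX; apply: formation_build => [gT rT G H f fGH XG piH|gT G N R nN nR].
  have nO := pseries_normal [:: pi^'; pi].
  apply: (formation_imquo fX fGH (nO _ G) (nO _ H) _ (XG _)) => /=.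
    by rewrite -fGH; apply: morphim_pseries.
  by apply: contra piH => piG; rewrite -fGH morphim_pgroup.
have nNR : N :&: R <| G by apply: normalI.
move=> /(local_at_quoP pi fX nN) XN /(local_at_quoP pi fX nR) XR.
apply/(local_at_quoP pi fX nNR) => /= piNR.
(* When G / M is a pi'-group the condition at M is void, and G itself takes the
   place of the pi'-by-pi subgroup over M. *)
have trivU (M : {group gT}) :
    M <| G -> pi^'.-nat #|G : M| -> normal_pi'pi pi G M G.
  move=> nM pM; split; first exact: normal_refl.
  by exists G; rewrite normal_refl normal_sub ?indexgg.
have pI (U T : {group gT}) : normal_pi'pi pi G N U -> normal_pi'pi pi G R T ->
    normal_pi'pi pi G (N :&: R) (U :&: T).
  case=> nU [V [nV sNV sVU pV pU]] [nT [W [nW sRW sWT pW pT]]].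
  split; first exact: normalI.
  exists (V :&: W)%G; split; rewrite ?normalI ?setISS //.
    by apply: (@pnat_index_setI _ _ G) => //; apply: normal_sub.
  by apply: (@pnat_index_setI _ _ G) => //; apply: normal_sub.
have [_ _ rX] := fX.
have [pN|pN] := boolP (pi^'.-nat #|G : N|).
  have [pR|/XR[T [pT XT]]] := boolP (pi^'.-nat #|G : R|).
    case/negP: piNR; rewrite -(setIid G).
    by apply: (@pnat_index_setI _ _ G); rewrite ?normal_sub.
  exists (G :&: T)%G; split; first by apply: pI => //; apply: trivU.
  have nT : T <| G by case: pT.
  by apply: quo_sub XT; rewrite //= (setIidPr (normal_sub nT)).
have [U [pU XU]] := XN pN; have nU : U <| G by case: pU.
have [pR|/XR[T [pT XT]]] := boolP (pi^'.-nat #|G : R|).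
  exists (U :&: G)%G; split; first by apply: pI => //; apply: trivU.
  by apply: quo_sub XU; rewrite //= (setIidPl (normal_sub nU)).
exists (U :&: T)%G; split; first exact: pI.
by apply: rX => //; case: pT.
Qed.

(** A pi'-subgroup at the bottom is absorbed in the pi'-core. *)
Lemma local_at_ker pi X (gT : finGroupType) (G D K : {group gT}) :
  formation X -> D <| G -> K <| G -> K \subset D -> pi^'.-nat #|D : K| ->
  local_at pi X (G / D)%G -> local_at pi X (G / K)%G.
Proof.
move=> fX nD nK sKD pDK /(local_at_quoP pi fX nD) XD.
apply/(local_at_quoP pi fX nK) => pGK; case: XD.
  apply: contra pGK => pGD.
  by rewrite -(Lagrange_index (normal_sub nD) sKD) pnatM pGD.
move=> U [[nU [V [nV sDV sVU pV pU]]] XU]; exists U; split=> //; split=> //.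
exists V; split=> //; first exact: subset_trans sKD sDV.
by rewrite -(Lagrange_index sDV sKD) pnatM pV.
Qed.

Lemma pcore_ext_quoP pi X (gT : finGroupType) (G N : {group gT}) :
  formation X -> N <| G ->
  pcore_ext pi X (G / N)%G <->
  exists U : {group gT},
    [/\ U <| G, N \subset U, pi.-nat #|U : N| & X _ (G / U)%G].
Proof.
move=> fX nNG; have [isoX _ _] := fX; rewrite /pcore_ext.
have nN' (U : {group gT}) : U <| G -> U \subset 'N(N).
  by move=> nU; apply: subset_trans (normal_sub nU) (normal_norm nNG).
split=> [XO|[U [nU sNU pU XU]]].
  have [U eU sNU nUG] := inv_quotientN nNG (pcore_normal pi (G / N)).
  have eO : 'O_pi(G / N)%G = (U / N)%G by apply: val_inj.
  exists U; split=> //; last by apply/(quo_quo isoX nNG nUG sNU); rewrite -eO.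
  by rewrite -card_quotient ?nN' //= -eU; apply: pcore_pgroup.
apply: quo_sub (_ : (U / N)%G \subset _) _ => //.
- exact: quotient_normal.
- exact: pcore_normal.
- by rewrite pcore_max ?quotient_normal // /pgroup card_quotient ?nN'.
by apply/quo_quo.
Qed.

Lemma pcore_extP pi X (gT : finGroupType) (G : {group gT}) :
  formation X ->
  pcore_ext pi X G <->
  exists U : {group gT}, [/\ U <| G, pi.-group U & X _ (G / U)%G].
Proof.
move=> fX; split=> [XG|[U [nU pU XU]]].
  by exists 'O_pi(G)%G; rewrite pcore_normal pcore_pgroup.
by apply: quo_sub (pcore_max pU nU) _ => //; apply: pcore_normal.
Qed.

Lemma pcore_ext_formation pi X : formation X -> formation (pcore_ext pi X).
Proof.
move=> fX; apply: formation_build => [gT rT G H f fGH XG|gT G N R nN nR].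
  have nO := pcore_normal pi.
  apply: (formation_imquo fX fGH (nO _ G) (nO _ H) _ XG) => /=.
  by rewrite -fGH; apply: morphim_pcore.
have nNR : N :&: R <| G by apply: normalI.
move=> /(pcore_ext_quoP pi fX nN)[U [nU sNU pU XU]].
move=> /(pcore_ext_quoP pi fX nR)[T [nT sRT pT XT]].
apply/(pcore_ext_quoP pi fX nNR); exists (U :&: T)%G; split.
- exact: normalI.
- exact: setISS.
- by apply: (@pnat_index_setI _ _ G) => //; apply: normal_sub.
by have [_ _ rX] := fX; apply: rX.
Qed.

Lemma sub_pcore_ext pi X : formation X -> subclass X (pcore_ext pi X).
Proof. by move=> [_ qX _] gT G XG; apply: qX => //; apply: pcore_normal. Qed.

(** G / 'O_{pi^', pi}(G) has no room for a further pi-group: a normal subgroup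
    of G that is a pi-group modulo 'O_{pi^', pi}(G) is pi'-by-pi. *)
Lemma local_at_pcore_ext pi X :
  formation X -> subclass (local_at pi (pcore_ext pi X)) (local_at pi X).
Proof.
move=> fX gT G XG; apply/(local_atP pi G fX) => /XG.
have [nO [V [nV _ sVO pV pO]]] := pseries2_normal_pi'pi pi G.
move=> /(pcore_ext_quoP pi fX nO)[U [nU sOU pU XU]].
exists U; split=> //; split=> //; exists V; split; rewrite ?sub1G //.
  exact: subset_trans sVO sOU.
by rewrite -(Lagrange_index sOU sVO) pnatM pU.
Qed.

Lemma local_at_mono pi X Y :
  subclass X Y -> subclass (local_at pi X) (local_at pi Y).
Proof. by move=> sXY gT G XG piG; apply: sXY; apply: XG. Qed.

Lemma local_at_ker1 pi X (gT : finGroupType) (G D : {group gT}) :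
  formation X -> D <| G -> pi^'.-group D ->
  local_at pi X (G / D)%G -> local_at pi X G.
Proof.
move=> fX nD pD XD; have [isoL _ _] := local_at_formation pi fX.
apply/(iso_closed_quo1 _ isoL).
apply: local_at_ker XD; rewrite ?normal1 ?sub1G ?indexg1 //.
Qed.

Lemma pcore_ext_preim pi X (gT rT : finGroupType) (G : {group gT})
    (H : {group rT}) (f : {morphism G >-> rT}) :
  formation X -> f @* G = H -> pi.-group ('ker f) ->
  pcore_ext pi X H -> pcore_ext pi X G.
Proof.
move=> fX fGH piK XH; have [isoX _ _] := fX.
have nO := pcore_normal pi H.
apply/(pcore_extP _ _ fX); exists (f @*^-1 'O_pi(H))%G; split.
- exact: preim_normal fGH nO.
- rewrite /pgroup card_morphpre ?fGH ?normal_sub // pnatM.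
  by apply/andP; split=> //; apply: pcore_pgroup.
exact/(quo_preim isoX fGH nO).
Qed.

(** * Wreath products with a group of order p *)

(** The wreath product of 'F_p with gT, in its regular action.  The base group
    consists of functions on the whole ambient type rather than on a subgroup,
    so that the same type serves all subgroups of gT. *)
Definition wreath (p : nat) (gT : finGroupType) : Type :=
  ({ffun gT -> 'F_p} * gT)%type.

Definition wreath_mul p gT (u v : wreath p gT) : wreath p gT :=
  ([ffun x => u.1 x + v.1 (x * u.2)%g]%R, u.2 * v.2).

Definition wreath_one p gT : wreath p gT := ([ffun=> 0%R], 1).

Definition wreath_inv p gT (u : wreath p gT) : wreath p gT :=
  ([ffun x => - u.1 (x * u.2^-1)%g]%R, u.2^-1).

Lemma wreath_mulA p gT : associative (@wreath_mul p gT).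
Proof.
move=> u v w; congr pair; last exact: mulgA.
by apply/ffunP=> x; rewrite !ffunE /= GRing.addrA mulgA.
Qed.

Lemma wreath_mul1 p gT : left_id (@wreath_one p gT) (@wreath_mul p gT).
Proof.
case=> f g; congr pair; last exact: mul1g.
by apply/ffunP=> x; rewrite !ffunE /= GRing.add0r mulg1.
Qed.

Lemma wreath_mulV p gT :
  left_inverse (@wreath_one p gT) (@wreath_inv p gT) (@wreath_mul p gT).
Proof.
move=> u; congr pair; last exact: mulVg.
by apply/ffunP=> x; rewrite !ffunE /= GRing.addNr.
Qed.

HB.instance Definition _ p gT :=
  Finite.copy (wreath p gT) ({ffun gT -> 'F_p} * gT)%type.
HB.instance Definition _ p gT := Finite_isGroup.Build (wreath p gT)
  (@wreath_mulA p gT) (@wreath_mul1 p gT) (@wreath_mulV p gT).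

Definition wreath_proj p gT (u : wreath p gT) : gT := u.2.

Lemma wreath_projM p gT : {morph (@wreath_proj p gT) : u v / u * v}.
Proof. by []. Qed.

Canonical wreath_proj_morphism p gT :=
  @Morphism _ _ [set: wreath p gT] _ (in2W (@wreath_projM p gT)).

(** The subgroup of the wreath product lying over G.  For H in G, the part over
    H is exactly the preimage of H under the projection of the part over G;
    this is what a subgroup functor can see. *)
Definition wreath_over p gT (G : {group gT}) : {group wreath p gT} :=
  (@wreath_proj p gT @*^-1 G)%G.

Lemma wreath_proj_im p gT (G : {group gT}) :
  @wreath_proj p gT @* wreath_over p G = G.
Proof.
apply: morphpreK; apply/subsetP=> g _.
by apply/morphimP; exists ([ffun=> 0%R], g).
Qed.

Lemma wreath_kerE p gT (u : wreath p gT) :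
  (u \in 'ker (@wreath_proj p gT)) = (u.2 == 1).
Proof. by rewrite !inE. Qed.

Lemma wreath_ker_card p gT :
  prime p -> #|'ker (@wreath_proj p gT)| = (p ^ #|gT|)%N.
Proof.
move=> p_pr; pose base (f : {ffun gT -> 'F_p}) : wreath p gT := (f, 1).
have inj_base : injective base by move=> f g [].
have -> : 'ker (@wreath_proj p gT) = [set base f | f in {: {ffun gT -> 'F_p}}].
  apply/setP=> -[f g]; rewrite wreath_kerE /=.
  by apply/eqP/imsetP => [->|[h _ [_ ->]] //]; exists f.
by rewrite card_imset // card_ffun card_Fp.
Qed.

Lemma wreath_ker_pgroup p gT : prime p -> p.-group ('ker (@wreath_proj p gT)).
Proof. by move=> p_pr; rewrite /pgroup wreath_ker_card // pnatX pnat_id. Qed.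

(** An element centralizing the indicator function of 1 has second component
    1, since it translates the argument by that component. *)
Lemma wreath_cent_ker p gT :
  'C('ker (@wreath_proj p gT)) \subset 'ker (@wreath_proj p gT).
Proof.
apply/subsetP=> u /centP cu; rewrite wreath_kerE; apply/eqP.
pose h : wreath p gT := ([ffun x : gT => ((x == 1%g)%:R : 'F_p)%R], 1).
have /cu uh : h \in 'ker (@wreath_proj p gT) by rewrite wreath_kerE.
have : (wreath_mul u h).1 1 = (wreath_mul h u).1 1.
  exact: (f_equal (fun v : wreath p gT => v.1 1) uh).
rewrite /wreath_mul /= !ffunE eqxx mul1g mulg1 GRing.addrC => /GRing.addIr.
by case: eqP.
Qed.

Definition wreath_res p (gT : finGroupType) (G : {group gT}) :=
  restrm_morphism (subsetT (wreath_over p G)) (wreath_proj_morphism p gT).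

Lemma wreath_res_im p (gT : finGroupType) (G : {group gT}) :
  wreath_res p G @* wreath_over p G = G.
Proof. by rewrite morphim_restrm setIid wreath_proj_im. Qed.

Lemma wreath_ker_sub p (gT : finGroupType) (G : {group gT}) :
  'ker (@wreath_proj p gT) \subset wreath_over p G.
Proof. by apply: morphpreS; apply: sub1G. Qed.

Lemma wreath_res_ker p (gT : finGroupType) (G : {group gT}) :
  'ker (wreath_res p G) = 'ker (@wreath_proj p gT).
Proof. by rewrite ker_restrm; apply/setIidPr/wreath_ker_sub. Qed.

(** The pi'-core meets the base group trivially, hence centralizes it, hence is
    contained in it. *)
Lemma wreath_over_pcore p pi (gT : finGroupType) (G : {group gT}) :
  prime p -> p \in pi -> 'O_pi^'(wreath_over p G) = 1.
Proof.
move=> p_pr pi_p; set W := wreath_over p G; set P := 'ker (@wreath_proj p gT).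
have pP : p.-group P by apply: wreath_ker_pgroup.
have piP : pi.-group P by apply: sub_in_pnat pP => q _ /eqnP->.
have sPW : P \subset W by apply: morphpreS; apply: sub1G.
have nPW : W \subset 'N(P) by apply: subset_trans (ker_norm _); apply: subsetT.
have nOW := pcore_normal pi^' W.
have tiOP : 'O_pi^'(W) :&: P = 1.
  rewrite setIC; apply: coprime_TIg.
  exact: pnat_coprime piP (pcore_pgroup _ _).
have /commG1P cOP : [~: 'O_pi^'(W), P] = 1.
  apply/trivgP; rewrite -tiOP; apply: commg_subI; rewrite subsetI subxx /=.
    by apply: subset_trans nPW; apply: normal_sub.
  by apply: subset_trans (normal_norm nOW).
rewrite -tiOP; apply/esym/setIidPl.
exact: subset_trans (wreath_cent_ker p gT).
Qed.

(** * Multiply local formations and their canonical definitions *)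

Lemma sigma_of_groupP (I : Type) (sigma : I -> nat_pred) (gT : finGroupType)
    (G : {group gT}) i :
  sigma_of_group sigma G i <-> ~~ (sigma i)^'.-group G.
Proof.
split=> [[p [sp pG]]|].
  apply/negP => /pgroupP piG; move: pG; rewrite mem_primes => /and3P[pr_p _ dv].
  by have /negP[] := piG p pr_p dv.
rewrite /pgroup /pnat cardG_gt0 => /allPn[p pG]; rewrite !inE negbK => sp.
by exists p.
Qed.

Lemma LFP (I : Type) (sigma : I -> nat_pred) (f : I -> gclass)
    (gT : finGroupType) (G : {group gT}) :
  LF sigma f G <-> forall i, local_at (sigma i) (f i) G.
Proof.
split=> [[G1 i|[_ fG] i piG]|fG].
- by rewrite /local_at G1 pgroup1.
- by apply: fG; apply/sigma_of_groupP.
have [G1|nG1] := eqVneq (G :> {set gT}) 1; [by left | right].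
by split=> // i /sigma_of_groupP; apply: fG.
Qed.

Lemma LF_formation (I : Type) (sigma : I -> nat_pred) (f : I -> gclass) :
  (forall i, formation (f i)) -> formation (LF sigma f).
Proof.
move=> ff; pose P F := exists i, F = local_at (sigma i) (f i).
have fP : formation (fun gT G => forall F, P F -> F gT G).
  by apply: formation_bigI => _ [i ->]; apply: local_at_formation.
apply: formation_eq fP => gT G; rewrite LFP.
by split=> [fG i|fG _ [i ->] //]; apply: fG; exists i.
Qed.

Section Local.

Variables (I : Type) (sigma : I -> nat_pred).
Hypothesis hsigma : prime_partition sigma.

Lemma block_prime i p : p \in sigma i -> prime p.
Proof. by case: hsigma => h _ _ _; apply: h. Qed.

Lemma pnat_blocksC i j n : i <> j -> (sigma i).-nat n -> (sigma j)^'.-nat n.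
Proof.
case: hsigma => _ _ disj _ nij; apply: sub_in_pnat => p _ pi; rewrite !inE.
by apply/negP => pj; apply: nij; apply: disj pi pj.
Qed.

(** Factoring out the normal subgroup 'O_(sigma i)(G) changes neither the
    condition at i, as it lies in the (sigma i)'-by-(sigma i) core, nor the
    condition at j != i, as it is a (sigma j)'-group. *)
Lemma pcore_ext_sub_LF (f : I -> gclass) i :
  (forall i, formation (f i)) ->
  subclass (pcore_ext (sigma i) (classI (f i) (LF sigma f))) (LF sigma f).
Proof.
move=> ff gT G [fO /LFP LO]; apply/LFP => j.
have nO := pcore_normal (sigma i) G; have pO := pcore_pgroup (sigma i) G.
have [<-|nij] := classic (i = j).
  apply/local_atP => // _; exists 'O_(sigma i)(G)%G; split=> //; split=> //.
  by exists 1%G; rewrite normal1 !sub1G ?indexg1 ?cards1.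
apply: local_at_ker1 nO _ (LO j) => //; exact: pnat_blocksC pO.
Qed.

(** If X = LF(x) has all x(j) inside X, then extending X by (sigma i)-groups
    replaces x(i) by X and keeps the other values.  The delicate direction
    starts from G with G / F_j(G) in X for every relevant j.  The X-residual D
    of G then lies in every F_j(G), which makes D the product of
    'O_(sigma i)(D) and a (sigma i)'-group, and G / 'O_(sigma i)(D) is in X. *)
Lemma pcore_ext_LF (x : I -> gclass) i :
  (forall j, formation (x j)) -> (forall j, subclass (x j) (LF sigma x)) ->
  eqclass (pcore_ext (sigma i) (LF sigma x))
    (LF sigma (fun j gT G => LF sigma x G /\ (j <> i -> x j gT G))).
Proof.
move=> fx sx gT G; set X := LF sigma x.
have fX : formation X by apply: LF_formation.
split=> [XO|/LFP XG].
  have nO := pcore_normal (sigma i) G; have pO := pcore_pgroup (sigma i) G.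
  apply/LFP => j; have [->|nij] := classic (j = i).
    have : local_at (sigma i) X G.
      apply/local_atP => // _; exists 'O_(sigma i)(G)%G; split=> //; split=> //.
      by exists 1%G; rewrite normal1 !sub1G ?indexg1 ?cards1.
    by apply: local_at_mono => hT H.
  have : local_at (sigma j) (x j) G.
    apply: local_at_ker1 nO _ _ => //; last by have /LFP := XO; apply.
    by apply: pnat_blocksC pO => eij; apply: nij.
  by apply: local_at_mono => hT H xH; split=> //; apply: sx xH.
(* D is the X-residual of G, which exists since G / G lies in X. *)
pose P D := D <| G /\ X _ (G / D)%G.
have [| |D [[nD XD] lD]] := @least_subgroup _ P G.
- split; first exact: normal_refl.
  by apply/LFP => j; rewrite /local_at /= trivg_quotient pgroup1.
- move=> N M [nN XN] [nM XM]; split; first exact: normalI.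
  by case: fX => _ _; apply.
have sDO j : ~~ (sigma j)^'.-group G -> D \subset 'O_{(sigma j)^', sigma j}(G).
  move=> pG; apply: (lD 'O_{(sigma j)^', sigma j}(G)%G).
  by split; [apply: pseries_normal | case: (XG j pG)].
(* K is the (sigma i)'-residual of D; it turns out to be 'O_(sigma i)(D). *)
pose Q K := [/\ K <| G, K \subset D & (sigma i)^'.-nat #|D : K|].
have [| |K [[nK sKD pDK] lK]] := @least_subgroup _ Q D.
- by split; rewrite ?indexgg.
- move=> N M [nN sN pN] [nM sM pM]; split; first exact: normalI.
    by rewrite subIset ?sN.
  rewrite -(setIid D); apply: (@pnat_index_setI _ _ G) => //; exact: normal_sub.
have [_ _ _ cover] := hsigma.
(* For a prime p of sigma j, j != i, D is a (sigma j)-group modulo the normal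
   (sigma j)'-subgroup D :&: V, so K lies in V and p does not divide #|K|. *)
have piK : (sigma i).-group K.
  apply/pgroupP => p pr_p pK; have [j pj] := cover p pr_p.
  have [<- //|nji] := classic (j = i).
  have dvKG : #|K| %| #|G| by apply/cardSg/normal_sub.
  have pjG : ~~ (sigma j)^'.-group G.
    apply/negP => /pgroupP/(_ p pr_p (dvdn_trans pK dvKG)).
    by rewrite !inE pj.
  have [nO [V [nV _ sVO]]] := pseries2_normal_pi'pi (sigma j) G.
  rewrite indexg1 => pV pOV.
  suff sKV : K \subset V.
    have /pgroupP/(_ p pr_p (dvdn_trans pK (cardSg sKV))) := pV.
    by rewrite !inE pj.
  suff : K \subset (D :&: V)%G by rewrite subsetI => /andP[].
  apply: lK; split; [exact: normalI | exact: subsetIl |].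
  apply: (@pnat_blocksC j) => //.
  have -> : #|D : D :&: V| = #|D :&: 'O_{(sigma j)^', sigma j}(G) : D :&: V|.
    by rewrite (setIidPl (sDO j pjG)).
  apply: (@pnat_index_setI _ _ G) => //; first exact: normal_sub.
    exact: normal_sub.
  by rewrite indexgg.
apply/(pcore_extP _ _ fX); exists K; split=> //; apply/LFP => j.
have [->|nji] := classic (j = i).
  by apply: local_at_ker pDK _ => //; have /LFP := XD; apply.
have : local_at (sigma j) (x j) G.
  by apply: local_at_mono (XG j) => hT H [_]; apply.
by have [_ q _] := local_at_formation (sigma j) (fx j); apply: q.
Qed.

(** For W over G, the core F_i(W) is 'O_(sigma i)(W) because 'O_(sigma i)^'(W)
    is trivial; and W is an extension of a (sigma i)-group, the base, by G. *)
Lemma wreath_LF (f : I -> gclass) i p (gT : finGroupType) (G : {group gT}) :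
  (forall i, formation (f i)) -> p \in sigma i ->
  LF sigma f (wreath_over p G) <->
  pcore_ext (sigma i) (classI (f i) (LF sigma f)) G.
Proof.
move=> ff ip; have p_pr := block_prime ip.
have fX := LF_formation sigma ff.
have fI := formation_classI (ff i) fX.
have projG := wreath_res_im p G.
have piker : (sigma i).-group ('ker (wreath_res p G)).
  rewrite wreath_res_ker; apply: sub_in_pnat (wreath_ker_pgroup gT p_pr) => q _.
  by move/eqnP->.
split=> [XW|XG]; last first.
  apply: (pcore_ext_sub_LF ff (i := i)).
  exact: pcore_ext_preim fI projG piker XG.
apply: (formation_im (pcore_ext_formation _ fI) projG).
have piW : ~~ (sigma i)^'.-group (wreath_over p G).
  apply/negP => /pgroupP/(_ p p_pr); rewrite !inE ip => /(_ _)/negP[] //.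
  apply: dvdn_trans (cardSg (wreath_ker_sub p G)).
  by rewrite wreath_ker_card // dvdn_exp // -cardsT cardG_gt0.
split; last by case: fX => _ q _; apply: q => //; apply: pcore_normal.
move/LFP: (XW) => /(_ i piW).
apply: quo_sub => //=; first exact: pseries_normal.
  exact: pcore_normal.
by rewrite (pseries_pop2 (sigma i) (wreath_over_pcore G p_pr ip)).
Qed.

(** multiply_local with the empty class added at every level.  The values at
    blocks that do not occur in F can then be made empty, and the condition on
    the values no longer refers to sigma_of_class. *)
Fixpoint multilocal (n : nat) (F : gclass) : Prop :=
  if n is m.+1 then
    formation F /\
    ((forall gT G, ~ F gT G) \/
     exists f : I -> gclass,
       (forall i, multilocal m (f i)) /\ eqclass F (LF sigma f))
  else formation F.

Lemma multilocal_formation n F : multilocal n F -> formation F.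
Proof. by case: n => [//|n] []. Qed.

Lemma multilocal_eq n F F' : eqclass F F' -> multilocal n F -> multilocal n F'.
Proof.
move=> e; case: n => [|n] /=; first exact: formation_eq.
case=> fF h; split; first exact: formation_eq e fF.
case: h => [h|[f [mf h]]]; [left=> gT G | right].
  by rewrite -e; apply: h.
by exists f; split=> // gT G; rewrite -e.
Qed.

Lemma multilocal_empty n F : (forall gT G, ~ F gT G) -> multilocal n F.
Proof.
move=> eF; have fF : formation F.
  by split=> [gT rT G H _ /eF|gT G N _ /eF|gT G N R _ _ /eF].
by case: n => [|n] //=; split=> //; left.
Qed.

Lemma multilocal_pred n F : multilocal n.+1 F -> multilocal n F.
Proof.
elim: n F => [|n IH] F [fF h] //=; split=> //.
case: h => [h|[f [mf h]]]; [by left | right].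
by exists f; split=> // i; apply: IH.
Qed.

Lemma multilocal_LF n (f : I -> gclass) :
  (forall i, multilocal n (f i)) -> multilocal n.+1 (LF sigma f).
Proof.
move=> mf; split; last by right; exists f.
by apply: LF_formation => i; apply: multilocal_formation (mf i).
Qed.

(** Choosing a function f for each member F of the family is avoided by
    intersecting over all functions that define a member. *)
Lemma multilocal_bigI n (P : gclass -> Prop) :
  (forall F, P F -> multilocal n F) ->
  multilocal n (fun gT G => forall F, P F -> F gT G).
Proof.
elim: n P => [|n IH] P mP /=; first exact: formation_bigI.
split; first by apply: formation_bigI => F /mP/multilocal_formation.
have [[F [PF eF]]|neP] := classic (exists F, P F /\ forall gT G, ~ F gT G).
  by left=> gT G /(_ F PF); apply: eF.
right; pose Q i g := exists F f,
  [/\ P F, forall i, multilocal n (f i), eqclass F (LF sigma f) & g = f i].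
exists (fun i gT G => forall g, Q i g -> g gT G); split.
  by move=> i; apply: IH => _ [F [f [_ mf _ ->]]].
move=> gT G; rewrite LFP; split=> [PG i piG _ [F [f [PF mf e ->]]]|QG F PF].
  by have /e/LFP := PG F PF; apply.
case: (mP F PF) => _ [eF|[f [mf e]]]; first by case: neP; exists F.
apply/e/LFP => i; apply: local_at_mono (QG i) => hT H; apply.
by exists F, f.
Qed.

Lemma multilocal_classI n X Y :
  multilocal n X -> multilocal n Y -> multilocal n (classI X Y).
Proof.
move=> mX mY; apply: multilocal_eq (classI_bigI X Y) _.
by apply: multilocal_bigI => F [] ->.
Qed.

Lemma LF_eq (f g : I -> gclass) :
  (forall i, eqclass (f i) (g i)) -> eqclass (LF sigma f) (LF sigma g).
Proof.
move=> e gT G; rewrite !LFP.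
by split=> fG i; apply: local_at_mono (fG i) => hT H; apply e.
Qed.

Lemma pcore_ext_eq pi X Y :
  eqclass X Y -> eqclass (pcore_ext pi X) (pcore_ext pi Y).
Proof. by move=> e gT G; apply: e. Qed.

(** LF(f) contains the quotients of its members, so cutting the values down to
    it loses nothing. *)
Lemma LF_classI (f : I -> gclass) : (forall i, formation (f i)) ->
  eqclass (LF sigma f) (LF sigma (fun i => classI (f i) (LF sigma f))).
Proof.
move=> ff gT G; split=> [fG|].
  apply/LFP => i piG; split; first by move/LFP: fG => /(_ i piG).
  have [_ q _] := LF_formation sigma ff.
  by apply: q => //; apply: pseries_normal.
by rewrite !LFP => fG i; apply: local_at_mono (fG i) => hT H [].
Qed.

Lemma multilocal_pcore_ext n i X :
  multilocal n X -> multilocal n (pcore_ext (sigma i) X).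
Proof.
case: n => [|n]; first exact: pcore_ext_formation.
move=> mX; have mX' := multilocal_pred mX; case: mX => fX [eX|[f [mf e]]].
  by apply: multilocal_empty => gT G; apply: eX.
have ff j : formation (f j) by apply: multilocal_formation (mf j).
pose x i := classI (f i) X.
have mx j : multilocal n (x j) by apply: multilocal_classI (mf j) mX'.
have fx j : formation (x j) by apply: multilocal_formation (mx j).
have ex : eqclass X (LF sigma x).
  move=> gT G; rewrite e (LF_classI ff); apply: LF_eq => j {}gT {}G.
  by rewrite /x /classI e.
have sx j : subclass (x j) (LF sigma x) by move=> gT G [_ /ex].
have := pcore_ext_LF i fx sx; set y := fun j => _.
have my j : multilocal n (y j).
  have [eij|nij] := classic (j = i).
    apply: multilocal_eq mX' => gT G; split=> [/ex XG|[/ex //]].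
    by split.
  apply: multilocal_eq (mx j) => gT G; split=> [xG|[_]]; last exact.
  by split=> //; apply: sx xG.
move=> ey; apply: multilocal_eq (multilocal_LF my) => gT G; rewrite -ey.
by apply: pcore_ext_eq => {}gT {}G; rewrite ex.
Qed.

(** Quantifying over all p in the block makes this commute with intersections
    of classes, which a choice of p depending on F would not. *)
Definition canonical_def (F : gclass) (i : I) : gclass := fun gT G =>
  forall p, p \in sigma i -> F _ (wreath_over p G).

(** This description transfers level n from the values of f to canonical_def;
    it holds for every f of level n defining F. *)
Lemma canonical_def_pcore_ext n F (f : I -> gclass) i :
  (forall i, multilocal n (f i)) -> eqclass F (LF sigma f) ->
  eqclass (canonical_def F i) (pcore_ext (sigma i) (classI (f i) F)).
Proof.
move=> mf e; have ff j : formation (f j) by apply: multilocal_formation (mf j).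
have [_ ne _ _] := hsigma; have [p ip] := ne i.
have eI : eqclass (pcore_ext (sigma i) (classI (f i) F))
    (pcore_ext (sigma i) (classI (f i) (LF sigma f))).
  by apply: pcore_ext_eq => gT G; rewrite /classI e.
move=> gT G; rewrite eI; split=> [FG|XG q iq].
  by apply/(wreath_LF G ff ip)/e/FG.
by apply/e/(wreath_LF G ff iq).
Qed.

Lemma canonical_def_local n F gT0 (G0 : {group gT0}) :
  multilocal n.+1 F -> F _ G0 ->
  (forall i, multilocal n (canonical_def F i)) /\
  eqclass F (LF sigma (canonical_def F)).
Proof.
move=> mF F0; have mF' := multilocal_pred mF.
case: mF => fF [/(_ _ _ F0) //|[f [mf e]]].
have mI i : multilocal n (classI (f i) F).
  exact: multilocal_classI (mf i) mF'.
split=> [i|gT G].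
  apply: multilocal_eq (multilocal_pcore_ext i (mI i)) => gT G.
  by symmetry; apply: (canonical_def_pcore_ext i mf e).
rewrite (LF_eq (fun i => canonical_def_pcore_ext i mf e)).
have ff j : formation (f j) by apply: multilocal_formation (mf j).
have eI : eqclass F (LF sigma (fun i => classI (f i) F)).
  move=> hT H; rewrite e (LF_classI ff); apply: LF_eq => j {}hT {}H.
  by rewrite /classI e.
rewrite eI !LFP; split=> FG i.
  apply: local_at_mono (FG i); apply: sub_pcore_ext.
  exact: multilocal_formation (mI i).
by apply: local_at_pcore_ext (FG i); apply: multilocal_formation (mI i).
Qed.

(** A nontrivial group has a prime in some block, where the empty value
    excludes it. *)
Lemma class1_LF : eqclass class1 (LF sigma (fun _ _ _ => False)).
Proof.
move=> gT G; split=> [G1|[//|[nG1 fG]]]; first by left.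
have [p pG] : exists p, p \in primes #|G|.
  exists (pdiv #|G|); rewrite mem_primes pdiv_dvd cardG_gt0 pdiv_prime //.
  by rewrite cardG_gt1.
have [_ _ _ cover] := hsigma.
have [i ip] : exists i, p \in sigma i.
  by apply: cover; move: pG; rewrite mem_primes => /and3P[].
by case: (fG i); exists p.
Qed.

Lemma multiply_localP n F : multiply_local sigma n F <->
  multilocal n F /\ (n <> 0%N -> exists gT (G : {group gT}), F gT G).
Proof.
elim: n F => [|n IH] F /=; first by split=> [|[]].
have F1 f : eqclass F (LF sigma f) -> exists gT (G : {group gT}), F gT G.
  by move=> e; exists {perm unit}, 1%G; apply/e; left.
split=> [[fF h]|[[fF h] neF]]; last first.
  split=> //; right; have [gT [G FG]] := neF (fun e => O_S _ (esym e)).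
  case: h => [/(_ _ _ FG) //|[f [mf e]]]; exists f; split=> // i.
    exact: multilocal_formation (mf i).
  move=> [hT [H [/e/LFP HF /sigma_of_groupP piH]]].
  by apply/IH; split=> // _; have := HF i piH; eexists; eexists; eassumption.
have [f [mf e]] : exists f : I -> gclass,
    (forall i, multilocal n (f i)) /\ eqclass F (LF sigma f).
  case: h => [e|[f [ff e mf]]].
    exists (fun _ _ _ => False); split.
      by move=> i; apply: multilocal_empty => gT G [].
    by move=> gT G; rewrite e class1_LF.
  exists (fun i gT G => sigma_of_class sigma F i /\ f i gT G); split.
    move=> i; have [si|nsi] := classic (sigma_of_class sigma F i); last first.
      by apply: multilocal_empty => gT G [].
    have [/multilocal_eq mi _] := (IH _).1 (mf i si).
    by apply: mi => gT G; split=> [|[]].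
  move=> gT G; split=> [FG|/LFP FG].
    apply/LFP => i piG; split; last by have /e/LFP := FG; apply.
    by exists gT, G; split=> //; apply/sigma_of_groupP.
  by apply/e/LFP => i; apply: local_at_mono (FG i) => hT H [].
by split=> [|_]; [split=> //; right; exists f | apply: F1 e].
Qed.
End Local.

(** * Subgroup functors *)

(** The image of H in G / U is in tau (G / U), and it is isomorphic to
    H / (U :&: H). *)
Lemma tau_quo (tau : subgroup_map) X (gT : finGroupType) (G U H : {group gT}) :
  subgroup_functor tau -> tau_closed tau X -> iso_closed X ->
  U <| G -> H \in tau gT G -> X _ (G / U)%G -> X _ (H / (U :&: H))%G.
Proof.
move=> [tsub _ tmor] tX iX nU tH XU.
have sHG := tsub _ _ _ tH; have nUG := normal_norm nU.
have im : restrm_morphism nUG (coset_morphism U) @* G = (G / U)%G.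
  by rewrite morphim_restrm setIid.
have tH' := (tmor _ _ _ _ _ im).1 H tH.
apply: iX (tX _ _ _ XU tH') => /=.
rewrite morphim_restrm (setIidPr sHG) isog_sym.
by apply: second_isog; exact: subset_trans sHG nUG.
Qed.

Lemma local_at_tau tau pi X :
  subgroup_functor tau -> formation X -> tau_closed tau X ->
  tau_closed tau (local_at pi X).
Proof.
move=> ht fX tX gT G H XG tH; have [tsub _ _] := ht; have [iX _ _] := fX.
have sHG := tsub _ _ _ tH.
apply/local_atP => // piH; have piG : ~~ pi^'.-group G.
  by apply: contra piH; apply: pgroupS.
have [nO [V [nV _ sVO pV pO]]] := pseries2_normal_pi'pi pi G.
exists ('O_{pi^', pi}(G) :&: H)%G; split; last first.
  exact: tau_quo ht tX iX (pseries_normal _ _) tH (XG piG).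
have nIH (W : {group gT}) : W <| G -> W :&: H <| H.
  by move=> nW; rewrite setIC; apply: normalGI nW.
split; first exact: nIH.
exists (V :&: H)%G; split.
- exact: nIH.
- exact: sub1G.
- exact: setSI.
- by rewrite indexg1; apply: pgroupS (subsetIl _ _) _; rewrite /pgroup -indexg1.
by apply: (@pnat_index_setIr _ _ G) => //; apply: normal_sub.
Qed.

(** * The join of two formations *)

(** The smallest formation containing A and B, when both are nonempty:
    H / (K1 :&: K2) is a subdirect product of a group in A and one in B, and G
    is a quotient of it.  As K1 :&: K2 need not be trivial, H may be replaced by
    any group mapping onto it. *)
Definition subdirect_join (A B : gclass) : gclass := fun gT G =>
  exists (hT : finGroupType) (H K1 K2 : {group hT}) (f : {morphism H >-> gT}),
    [/\ f @* H = G, K1 <| H /\ K2 <| H, A _ (H / K1)%G, B _ (H / K2)%G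
      & K1 :&: K2 \subset 'ker f].

(** The fibre product of H, L and G over two quotients of G. *)
Lemma fibre_product (hT lT gT k1T k2T : finGroupType) (H : {group hT})
   (L : {group lT}) (G : {group gT})
   (phi : {morphism H >-> k1T}) (psi : {morphism L >-> k2T})
   (c1 : {morphism G >-> k1T}) (c2 : {morphism G >-> k2T}) :
  phi @* H = c1 @* G -> psi @* L = c2 @* G ->
  exists (eT : finGroupType) (E : {group eT}) (p1 : {morphism E >-> hT})
    (p2 : {morphism E >-> lT}) (p3 : {morphism E >-> gT}),
    [/\ p1 @* E = H, p2 @* E = L, p3 @* E = G &
     {in E, forall u, phi (p1 u) = c1 (p3 u) /\ psi (p2 u) = c2 (p3 u)}].
Proof.
move=> e1 e2.
pose E : {set (hT * lT * gT)%type} :=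
  [set u | [&& u.1.1 \in H, u.1.2 \in L, u.2 \in G,
     phi u.1.1 == c1 u.2 & psi u.1.2 == c2 u.2]].
have gE : group_set E.
  apply/group_setP; split=> [|u v]; first by rewrite !inE !group1 !morph1 !eqxx.
  rewrite !inE => /and5P[u1 u2 u3 /eqP u4 /eqP u5].
  move=> /and5P[v1 v2 v3 /eqP v4 /eqP v5].
  by rewrite !groupM //= !morphM // u4 u5 v4 v5 !eqxx.
pose EG := Group gE.
pose q1 (u : (hT * lT * gT)%type) := u.1.1.
pose q2 (u : (hT * lT * gT)%type) := u.1.2.
pose q3 (u : (hT * lT * gT)%type) := u.2.
have q1M : {in EG &, {morph q1 : u v / u * v}} by [].
have q2M : {in EG &, {morph q2 : u v / u * v}} by [].
have q3M : {in EG &, {morph q3 : u v / u * v}} by [].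
have inE' u : u \in EG -> [/\ u.1.1 \in H, u.1.2 \in L, u.2 \in G,
    phi u.1.1 = c1 u.2 & psi u.1.2 = c2 u.2].
  by rewrite inE => /and5P[? ? ? /eqP ? /eqP ?].
have mkE h l g : h \in H -> l \in L -> g \in G -> phi h = c1 g ->
    psi l = c2 g -> (h, l, g) \in EG.
  by move=> hH lL gG e e'; rewrite inE /= hH lL gG e e' !eqxx.
have liftH g : g \in G -> exists2 h, h \in H & phi h = c1 g.
  move=> gG; have : c1 g \in phi @* H by rewrite e1 mem_morphim.
  by case/morphimP=> h _ hH ->; exists h.
have liftL g : g \in G -> exists2 l, l \in L & psi l = c2 g.
  move=> gG; have : c2 g \in psi @* L by rewrite e2 mem_morphim.
  by case/morphimP=> l _ lL ->; exists l.
exists _, EG, (Morphism q1M), (Morphism q2M), (Morphism q3M); split.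
- apply/setP=> h; apply/morphimP/idP => [[u uE _ ->]|hH].
    by case/inE': uE.
  have : phi h \in c1 @* G by rewrite -e1 mem_morphim.
  case/morphimP=> g _ gG eg; have [l lL el] := liftL g gG.
  by exists (h, l, g) => //; apply: mkE.
- apply/setP=> l; apply/morphimP/idP => [[u uE _ ->]|lL].
    by case/inE': uE.
  have : psi l \in c2 @* G by rewrite -e2 mem_morphim.
  case/morphimP=> g _ gG eg; have [h hH eh] := liftH g gG.
  by exists (h, l, g) => //; apply: mkE.
- apply/setP=> g; apply/morphimP/idP => [[u uE _ ->]|gG].
    by case/inE': uE.
  have [h hH eh] := liftH g gG; have [l lL el] := liftL g gG.
  by exists (h, l, g) => //; apply: mkE.
by move=> u /inE'[].
Qed.

(** If G / N and G / R are images of H and L, the fibre product of H, L and G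
    maps onto H and L, which provides the two normal subgroups, and onto
    G / (N :&: R). *)
Lemma subdirect_join_formation A B :
  formation A -> formation B -> formation (subdirect_join A B).
Proof.
move=> fA fB; apply: formation_build => [gT rT G H f fGH|gT G N R nN nR].
  case=> hT [L [K1 [K2 [g [gLG nK AK BK sK]]]]].
  have [q [qL kq]] := comp_surj f gLG (subxx G).
  exists hT, L, K1, K2, q; split=> //; first by rewrite qL.
  apply: subset_trans sK _; rewrite kq; exact: (morphpreS g (sub1G _)).
case=> hT [H [K1 [K2 [phi [im1 [nK1 nK2] AK BK sK]]]]].
case=> lT [L [T1 [T2 [psi [im2 [nT1 nT2] AT BT sT]]]]].
pose c1 := restrm_morphism (normal_norm nN) (coset_morphism N).
pose c2 := restrm_morphism (normal_norm nR) (coset_morphism R).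
have imc1 : c1 @* G = G / N by rewrite morphim_restrm setIid.
have imc2 : c2 @* G = G / R by rewrite morphim_restrm setIid.
have [||eT [E [p1 [p2 [p3 [e1 e2 e3 comm]]]]]] :=
    @fibre_product _ _ _ _ _ H L G phi psi c1 c2.
- by rewrite im1 imc1.
- by rewrite im2 imc2.
have nNR : N :&: R <| G by apply: normalI.
have [q [qE kq]] := comp_surj (coset_morphism (N :&: R)) e3 (normal_norm nNR).
have [iA _ rA] := fA; have [iB _ rB] := fB.
exists eT, E, (p1 @*^-1 K1 :&: p2 @*^-1 T1)%G.
exists (p1 @*^-1 K2 :&: p2 @*^-1 T2)%G, q.
split=> //.
- by split; apply: normalI; apply: preim_normal; eassumption.
- apply: rA; [exact: preim_normal e1 nK1 | exact: preim_normal e2 nT1 | |].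
    exact/(quo_preim iA e1 nK1).
  exact/(quo_preim iA e2 nT1).
- apply: rB; [exact: preim_normal e1 nK2 | exact: preim_normal e2 nT2 | |].
    exact/(quo_preim iB e1 nK2).
  exact/(quo_preim iB e2 nT2).
rewrite kq ker_coset; apply/subsetP=> u; rewrite !inE.
case/andP=> /andP[/andP[uE u1] /andP[_ v1]] /andP[/andP[_ u2] /andP[_ v2]].
have [c1u c2u] := comm u uE.
have uG : p3 u \in G by rewrite -e3 mem_morphim.
have k1 : phi (p1 u) = 1 by apply/mker/(subsetP sK); rewrite inE u1.
have k2 : psi (p2 u) = 1 by apply/mker/(subsetP sT); rewrite inE v1.
rewrite uE /=; apply/andP; split; apply: coset_idr.
- by apply: (subsetP (normal_norm nN)).
- by rewrite k1 in c1u.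
- by apply: (subsetP (normal_norm nR)).
by rewrite k2 in c2u.
Qed.

Lemma subdirect_join_tau tau A B : subgroup_functor tau ->
  formation A -> formation B -> tau_closed tau A -> tau_closed tau B ->
  tau_closed tau (subdirect_join A B).
Proof.
move=> ht fA fB tA tB gT G T [hT [H [K1 [K2 [f [fHG [nK1 nK2] AK BK sK]]]]]] tT.
have [tsub _ tmor] := ht; have tS := (tmor _ _ _ _ _ fHG).2 T tT.
have sTG := tsub _ _ _ tT; have [iA _ _] := fA; have [iB _ _] := fB.
set S := (f @*^-1 T)%G in tS; have sSH : S \subset H by apply: subsetIl.
have nI (W : {group hT}) : W <| H -> W :&: S <| S.
  by move=> nW; rewrite setIC; apply: normalGI nW.
exists hT, S, (K1 :&: S)%G, (K2 :&: S)%G, (restrm_morphism sSH f); split.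
- by rewrite morphim_restrm setIid /= morphpreK // fHG.
- by split; apply: nI.
- exact: tau_quo ht tA iA nK1 tS AK.
- exact: tau_quo ht tB iB nK2 tS BK.
rewrite ker_restrm subsetI; apply/andP; split.
  by apply: subset_trans (subsetIl _ _) (subsetIr _ _).
by apply: subset_trans sK; apply: setISS; apply: subsetIl.
Qed.

Lemma sub_subdirect_join A B (rT : finGroupType) (R : {group rT}) :
  formation A -> formation B -> B _ R ->
  subclass A (subdirect_join A B).
Proof.
move=> [iA _ _] fB BR gT G AG.
exists gT, G, 1%G, G, (idm_morphism G); split.
- exact: morphim_idm.
- by split; [apply: normal1 | apply: normal_refl].
- exact: (iso_closed_quo1 G iA).1 AG.
- exact: formation_trivial fB BR (trivg_quotient G).
by apply: subset_trans (subsetIl _ _) (sub1G _).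
Qed.

Lemma subdirect_joinC A B : subclass (subdirect_join A B) (subdirect_join B A).
Proof.
move=> gT G [hT [H [K1 [K2 [f [fH [n1 n2] AK BK sK]]]]]].
by exists hT, H, K2, K1, f; split=> //; rewrite setIC.
Qed.

(** With N the kernel of f, the groups H / K1 and H / (K1 :&: N) K2 are in F,
    and by Dedekind's law K1 :&: (K1 :&: N) K2 = (K1 :&: N) (K1 :&: K2), which
    lies in N. *)
Lemma subdirect_join_modular A B C F :
  formation A -> formation B -> formation C -> formation F ->
  subclass A C -> subclass A F -> subclass (classI B C) F ->
  subclass (classI (subdirect_join A B) C) F.
Proof.
move=> fA fB fC fF sAC sAF sBCF gT G.
case=> [[hT [H [K1 [K2 [f [fHG [n1 n2] AK BK sK]]]]]] CG].
set N := ('ker f)%G; have nN : N <| H by apply: ker_normal.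
have toF X : formation X -> X _ (H / N)%G <-> X _ G.
  move=> [iX _ _]; split; apply: iX; rewrite -fHG; first exact: first_isog.
  by rewrite isog_sym; apply: first_isog.
have CN : C _ (H / (K1 :&: N))%G.
  by have [_ _ r] := fC; apply: r => //; [apply: sAC | apply/toF].
have nNK : K1 :&: N <| H by apply: normalI.
have nJ : (K1 :&: N) <*> K2 <| H by apply: normalY.
have FJ : F _ (H / ((K1 :&: N) <*> K2))%G.
  apply: sBCF; split; first by apply: quo_sub BK => //=; apply: joing_subr.
  by apply: quo_sub CN => //=; apply: joing_subl.
apply/(toF F fF); have [_ _ rF] := fF.
have := rF _ H K1 _ n1 nJ (sAF _ _ AK) FJ.
apply: quo_sub => //; first exact: normalI.
rewrite /= norm_joinEl; last first.
  by apply: subset_trans (normal_sub nNK) (normal_norm n2).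
rewrite setIC -group_modl ?subsetIl // mul_subG ?subsetIr //.
by rewrite setIC.
Qed.

(** * The modular law *)

Section Modular.

Variables (I : Type) (sigma : I -> nat_pred).
Hypothesis hsigma : prime_partition sigma.
Variable (tau : subgroup_map).
Hypothesis htau : subgroup_functor tau.

Lemma LF_tau (f : I -> gclass) :
  (forall i, formation (f i)) -> (forall i, tau_closed tau (f i)) ->
  tau_closed tau (LF sigma f).
Proof.
move=> ff tf gT G H /LFP FG tH; apply/LFP => i.
exact: local_at_tau htau (ff i) (tf i) _ _ _ (FG i) tH.
Qed.

(** The part of the wreath product over H is the preimage of H, so it belongs to
    tau of the part over G. *)
Lemma canonical_def_tau F i :
  tau_closed tau F -> tau_closed tau (canonical_def sigma F i).
Proof.
move=> tF gT G H FG tH p ip; have [tsub _ tmor] := htau.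
apply: tF (FG p ip) _.
have -> : wreath_over p H = (wreath_res p G @*^-1 H)%G.
  apply: val_inj; rewrite /= morphpre_restrm; apply/esym/setIidPr.
  by apply: morphpreS; apply: tsub tH.
by apply: (tmor _ _ _ _ _ (wreath_res_im p G)).2.
Qed.

Definition tau_multilocal n F := tau_closed tau F /\ multilocal sigma n F.

Definition tau_multilocal_join n A B : gclass := fun gT G =>
  forall F, tau_multilocal n F -> subclass A F -> subclass B F -> F gT G.

Lemma tau_multilocal_joinW n A B :
  tau_multilocal n (tau_multilocal_join n A B).
Proof.
split=> [gT G H JG tH F mF sAF sBF|].
  by have [tF _] := mF; apply: tF tH; apply: JG.
pose P F := [/\ tau_multilocal n F, subclass A F & subclass B F].
have mP : multilocal sigma n (fun gT G => forall F, P F -> F gT G).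
  by apply: multilocal_bigI => F [[]].
apply: multilocal_eq mP => gT G.
by split=> [JG F mF sA sB|JG F [mF sA sB]]; apply: JG.
Qed.

Lemma tau_multilocal_classI n A B :
  tau_multilocal n A -> tau_multilocal n B -> tau_multilocal n (classI A B).
Proof.
move=> [tA mA] [tB mB]; split; last exact: multilocal_classI.
by move=> gT G H [AG BG] tH; split; [apply: tA tH | apply: tB tH].
Qed.

Lemma canonical_def_tau_multilocal n F gT0 (G0 : {group gT0}) :
  tau_multilocal n.+1 F -> F _ G0 ->
  (forall i, tau_multilocal n (canonical_def sigma F i)) /\
  eqclass F (LF sigma (canonical_def sigma F)).
Proof.
move=> [tF mF] F0; have [mc e] := canonical_def_local hsigma mF F0.
by split=> // i; split=> //; apply: canonical_def_tau.
Qed.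

(** In the induction step, write a, b, c for the canonical functions of A, B, C.
    LF of the pointwise join of a and b contains A and B, hence G.  Writing
    F_i(G) for 'O_{(sigma i)^', sigma i}(G), it follows that G / F_i(G) lies in
    the join of a(i) and b(i), and in c(i).  By the induction hypothesis
    it lies in every class of level n containing a(i) and the intersection of
    b(i) and c(i), in particular in the canonical value at i of any F that
    contains A and the intersection of B and C. *)
Lemma tau_multilocal_modular n A B C :
  tau_multilocal n A -> tau_multilocal n B -> tau_multilocal n C ->
  subclass A C ->
  subclass (classI (tau_multilocal_join n A B) C)
    (tau_multilocal_join n A (classI B C)).
Proof.
elim: n A B C => [|n IH] A B C.
all: move=> mA mB mC sAC gT G [JG CG] F mF sAF sIF.
(* If one of A and B is empty, their join lies in the other one. *)
all: have [[gA [GA AGA]]|eA] := classic (exists gT (G : {group gT}), A gT G);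
  last by apply: sIF; split=> //; apply: JG => // hT H AH;
    case: eA; exists hT, H.
all: have [[gB [GB BGB]]|eB] := classic (exists gT (G : {group gT}), B gT G);
  last by apply: sAF; apply: JG => // hT H BH; case: eB; exists hT, H.
  have [[tA fA] [tB fB]] := (mA, mB); have [[_ fC] [_ fF]] := (mC, mF).
  apply: (subdirect_join_modular fA fB fC fF sAC sAF sIF); split=> //.
  apply: JG.
  - by split; [apply: subdirect_join_tau | apply: subdirect_join_formation].
  - exact: sub_subdirect_join fA fB BGB.
  move=> hT H BH; apply: subdirect_joinC.
  exact: sub_subdirect_join fB fA AGA _ _ BH.
have [ma eAa] := canonical_def_tau_multilocal mA AGA.
have [mb eBb] := canonical_def_tau_multilocal mB BGB.
have [mc eCc] := canonical_def_tau_multilocal mC CG.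
have [mf eFf] := canonical_def_tau_multilocal mF (sAF _ _ AGA).
pose J i :=
  tau_multilocal_join n (canonical_def sigma A i) (canonical_def sigma B i).
have mJ i : tau_multilocal n (J i) by apply: tau_multilocal_joinW.
have LG : LF sigma J G.
  apply: JG.
  - split; last by apply: multilocal_LF => i; case: (mJ i).
    by apply: LF_tau => i; case: (mJ i) => // _ /multilocal_formation.
  - move=> hT H /eAa/LFP AH; apply/LFP => i.
    by apply: local_at_mono (AH i) => kT K cK X _ sX _; apply: sX.
  move=> hT H /eBb/LFP BH; apply/LFP => i.
  by apply: local_at_mono (BH i) => kT K cK X _ _ sX; apply: sX.
apply/eFf/LFP => i piG.
have JO := (LFP _ _ _).1 LG i piG.
have CO := (LFP _ _ _).1 ((eCc _ _).1 CG) i piG.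
apply: (IH _ _ _ (ma i) (mb i) (mc i) _ _ _ (conj JO CO)) => //.
- by move=> hT H AH p ip; apply: sAC; apply: AH.
- by move=> hT H AH p ip; apply: sAF; apply: AH.
by move=> hT H [BH CH] p ip; apply: sIF; split; [apply: BH | apply: CH].
Qed.

(** For n > 0, class1 and every LF(f) contain the trivial groups; for n = 0
    the empty class is a formation. *)
Lemma l_tau_sigmaP n F : l_tau_sigma sigma tau n F <->
  tau_multilocal n F /\ (n <> 0%N -> exists gT (G : {group gT}), F gT G).
Proof.
by rewrite /l_tau_sigma multiply_localP // /tau_multilocal and_assoc.
Qed.

(** For n > 0 a class containing A is nonempty, as A is; so admitting the empty
    class does not change the intersection. *)
Lemma join_tau_sigmaE n A B : l_tau_sigma sigma tau n A ->
  eqclass (join_tau_sigma sigma tau n A B) (tau_multilocal_join n A B).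
Proof.
move=> /l_tau_sigmaP[mA nA] gT G; split=> JG F mF sA sB; last first.
  by apply: JG => //; case/l_tau_sigmaP: mF.
apply: JG => //; apply/l_tau_sigmaP; split=> // n0.
by have [hT [H AH]] := nA n0; exists hT, H; apply: sA.
Qed.

Lemma tau_multilocal_eq n F F' :
  eqclass F F' -> tau_multilocal n F -> tau_multilocal n F'.
Proof.
move=> e [tF mF]; split; last exact: multilocal_eq e mF.
by move=> gT G H /e FG /(tF _ _ _ FG)/e.
Qed.

End Modular.

Theorem theorem3p5 (I : Type) (sigma : I -> nat_pred)
  (hsigma : prime_partition sigma)
  (tau : subgroup_map) (htau : subgroup_functor tau) (n : nat) :
  modular_lattice (l_tau_sigma sigma tau n) classI (join_tau_sigma sigma tau n).
Proof.
have lP := l_tau_sigmaP hsigma tau n.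
have JE A B (LA : l_tau_sigma sigma tau n A) := join_tau_sigmaE hsigma B LA.
have LI A B : l_tau_sigma sigma tau n A -> l_tau_sigma sigma tau n B ->
    l_tau_sigma sigma tau n (classI A B).
  move=> /lP[mA nA] /lP[mB nB]; apply/lP; split=> [|n0].
    exact: tau_multilocal_classI.
  have [[gA [GA AGA]] [gB [GB BGB]]] := (nA n0, nB n0).
  have [[_ /multilocal_formation fA] [_ /multilocal_formation fB]] := (mA, mB).
  exists gA, 1%G; split; first exact: formation_trivial fA AGA _.
  exact: formation_trivial fB BGB _.
split=> [A B LA LB|A B C LA LB LC sAC].
  split.
    split; [exact: LI | by move=> gT G [] | by move=> gT G [] |].
    by move=> C _ sCA sCB gT G CG; split; auto.
  have [mA nA] := (lP A).1 LA.
  have sA : subclass A (join_tau_sigma sigma tau n A B).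
    by move=> gT G AG F _ sA _; apply: sA.
  split=> //.
  - apply/lP; split.
      apply: tau_multilocal_eq (tau_multilocal_joinW sigma tau n A B) => gT G.
      by symmetry; apply: JE.
    by move=> /nA[gT [G AG]]; exists gT, G; apply: sA.
  - by move=> gT G BG F _ _ sB; apply: sB.
  by move=> C LC sAC sBC gT G; apply.
move=> gT G; split=> [JG|[/(JE _ _ LA) JG CG]].
  split; last by apply: JG => // hT H [].
  by move=> F LF sA sB; apply: JG => // hT H [BH _]; apply: sB.
apply/(JE _ _ LA).
have [[mA _] [mB _] [mC _]] := And3 ((lP A).1 LA) ((lP B).1 LB) ((lP C).1 LC).
exact: (tau_multilocal_modular hsigma htau mA mB mC sAC (conj JG CG)).
Qed.
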